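(* Let $\mathbb{F}$ be a finite field of characteristic $q>2$, fix a monomial order that refines total degree, and let $f(\bar x)=\prod_{i=1}^n(1-x_i)-2$. Let $g(\bar x,\bar y)\in\mathbb{F}[x_1,\dots,x_n,y_1,\dots,y_n]$ satisfy $g(\bar x,\bar y)\cdot f(\bar x\circ\bar y)=1 \pmod{\bar x^2-\bar x}$. Then $$\big|\mathrm{LM}\big(\{\mathrm{ml}(g(\bar x,\mathbb{1}_S)) : S\subseteq[n]\}\big)\big|=2^n.$$
   Context: $\bar x\circ\bar y=(x_1y_1,\dots,x_ny_n)$. $\mathbb{1}_S\in\{0,1\}^n$ is the indicator vector of $S$. ''mod $\bar x^2-\bar x$'' means modulo the ideal generated by $x_i^2-x_i$. $\mathrm{ml}(h)$ is the multilinear polynomial obtained by replacing every positive exponent by $1$. $\mathrm{LM}(h)$ is the leading monomial of $h$ with respect to the fixed monomial order, and $\mathrm{LM}$ of a set is the set of leading monomials of its elements. *)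

(* Defs.v *)
From mathcomp Require Import all_boot all_order all_algebra all_field.
From mathcomp Require Import finmap mpoly.

Set Implicit Arguments.
Unset Strict Implicit.
Unset Printing Implicit Defensive.

Import GRing.Theory.
Local Open Scope ring_scope.

Definition eq_mod_ideal (R : comNzRingType) (I : finType) (gs : I -> R)
    (p r : R) : Prop :=
  exists a : I -> R, p - r = \sum_(i : I) a i * gs i.

Definition monomial_order (n : nat) (le : rel 'X_{1..n}) : Prop :=
  [/\ reflexive le, antisymmetric le, transitive le & total le] /\
  (forall m : 'X_{1..n}, le 0%MM m) /\
  (forall m1 m2 m : 'X_{1..n}, le m1 m2 -> le (m1 + m)%MM (m2 + m)%MM).

Definition refines_degree (n : nat) (le : rel 'X_{1..n}) : Prop :=
  forall m1 m2 : 'X_{1..n}, (mdeg m1 < mdeg m2)%N -> le m1 m2 && (m1 != m2).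

Section Polynomials.

Variables (F : fieldType) (n : nat).

(* For a total order le, LM le h is None exactly when h = 0, so LM_set collects
   the leading monomials of the nonzero elements. *)
Definition LM (le : rel 'X_{1..n}) (h : {mpoly F[n]}) : option 'X_{1..n} :=
  ohead [seq m <- msupp h | all (fun m' => le m' m) (msupp h)].

Definition LM_set (le : rel 'X_{1..n}) (A : {fset {mpoly F[n]}}) :
    {fset 'X_{1..n}} :=
  [fset m in pmap (LM le) A]%fset.

Definition ml (h : {mpoly F[n]}) : {mpoly F[n]} :=
  \sum_(m <- msupp h) h@_m *: 'X_[[multinom ((0 < m i)%N : nat) | i < n]].

Definition f_prod : {mpoly F[n]} := \prod_(i < n) (1 - 'X_i) - 2%:R.

(* F[x, y] is {mpoly F[n + n]}: the first n variables are the x_i, the last n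
   are the y_i. *)
Definition xvar (i : 'I_n) : {mpoly F[n + n]} := 'X_(lshift n i).
Definition yvar (i : 'I_n) : {mpoly F[n + n]} := 'X_(rshift n i).

(* h(x \circ y) *)
Definition hadamard_lift (h : {mpoly F[n]}) : {mpoly F[n + n]} :=
  h \mPo [tuple xvar i * yvar i | i < n].

(* g(x, 1_S) *)
Definition subst_indicator (g : {mpoly F[n + n]}) (S : {set 'I_n}) :
    {mpoly F[n]} :=
  g \mPo [tuple match split k with
                | inl i => 'X_i
                | inr j => ((j \in S)%:R)%:MP
                end | k < n + n].

(* For n > 0 no polynomial g satisfies g * f(x \circ y) = 1 modulo the
   x_i^2 - x_i alone: at x = (1, ..., 1) it would make \prod_i (1 - y_i) - 2 a
   unit of F[y].  The identity is satisfiable when the y_i are Boolean too,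
   i.e. modulo xy_axiom, whose ideal contains that of x_axiom. *)
Definition x_axiom (i : 'I_n) : {mpoly F[n + n]} := xvar i ^+ 2 - xvar i.

Definition xy_axiom (k : 'I_(n + n)) : {mpoly F[n + n]} := 'X_k ^+ 2 - 'X_k.

End Polynomials.

Arguments f_prod : clear implicits.
Arguments x_axiom : clear implicits.
Arguments xy_axiom : clear implicits.

(* Main.v *)
Require Import Defs.
From mathcomp Require Import all_boot all_order all_algebra all_field.
From mathcomp Require Import finmap mpoly ring.

Set Implicit Arguments.
Unset Strict Implicit.
Unset Printing Implicit Defensive.

Import GRing.Theory.
Local Open Scope ring_scope.

(** For Boolean [x], the value [w] of [\prod_(i in S) (1 - x_i)] satisfies
    [w ^ 2 = w], so [(w - 2) * (- (1 + w) / 2) = 1].  Hence [g(x, 1_S)] agrees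
    on the cube with [- (1 + \prod_(i in S) (1 - x_i)) / 2].  A multilinear
    polynomial is determined by its values on the cube, so [ml (g(x, 1_S))] is
    this polynomial.  Its unique monomial of largest degree is
    [\prod_(i in S) x_i], and distinct [S] give distinct leading monomials. *)

(** * Multilinear polynomials as functions on the Boolean cube *)

Section BooleanCube.

Variables (F : fieldType) (n : nat).
Implicit Types (A S : {set 'I_n}) (p : {mpoly F[n]}).

Definition indicator A : 'I_n -> F := fun i => (i \in A)%:R.

(** Square-freeness is phrased through [mesym1] so that monomials are indexed by the same sets as
    the points of the cube. *)
Definition multilinear p : Prop :=
  forall m, m \in msupp p -> exists A, m = mesym1 A.

Lemma multilinearB p1 p2 :
  multilinear p1 -> multilinear p2 -> multilinear (p1 - p2).
Proof.
by move=> h1 h2 m /msuppB_le; rewrite mem_cat => /orP[/h1|/h2].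
Qed.

Lemma meval_indicator_mesym1 A S :
  'X_[mesym1 S].@[indicator A] = (S \subset A)%:R :> F.
Proof.
rewrite mevalX; have [/subsetP sSA|/subsetPn[i iS iA]] := boolP (S \subset A).
  apply: big1 => i _; rewrite mnmE /indicator.
  by case: (boolP (i \in S)) => [/sSA ->|_]; rewrite ?expr1 ?expr0.
by rewrite (bigD1 i) //= mnmE iS /indicator (negbTE iA) expr1 mul0r.
Qed.

(* Induction on [#|A|]: at [1_A] only the monomials of subsets of [A] survive. *)
Lemma multilinear_eq0 p :
  multilinear p -> (forall A, p.@[indicator A] = 0) -> p = 0.
Proof.
move=> mlp p0.
have coef0 k A : (#|A| < k)%N -> p@_(mesym1 A) = 0.
  elim: k A => [//|k IHk] A ltAk; apply/eqP; apply: contraT => nz.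
  have Am : mesym1 A \in msupp p by rewrite mcoeff_msupp.
  have := p0 A; rewrite {1}[p]mpolyE raddf_sum /= (bigD1_seq (mesym1 A)) //=.
  rewrite big_seq_cond big1 => [|m /andP[mp neqm]].
    rewrite addr0 mevalZ meval_indicator_mesym1 subxx mulr1 => pA.
    by rewrite pA eqxx in nz.
  have [B defm] := mlp m mp; rewrite {m}defm in mp neqm *.
  rewrite mevalZ meval_indicator_mesym1.
  have [sBA|] := boolP (B \subset A); last by rewrite mulr0.
  rewrite IHk ?mul0r // (leq_trans _ (ltnSE ltAk)) //.
  apply: proper_card; rewrite properEneq sBA andbT.
  by apply: contra neqm => /eqP ->.
apply/mpolyP => m; rewrite mcoeff0.
have [/mlp[A ->]|/memN_msupp_eq0 //] := boolP (m \in msupp p).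
exact: coef0 (ltnSn _).
Qed.

Lemma multilinear_inj p1 p2 : multilinear p1 -> multilinear p2 ->
  (forall A, p1.@[indicator A] = p2.@[indicator A]) -> p1 = p2.
Proof.
move=> ml1 ml2 eq12; apply/eqP; rewrite -subr_eq0; apply/eqP.
apply: multilinear_eq0 => [|A]; first exact: multilinearB.
by rewrite mevalB eq12 subrr.
Qed.

Lemma multilinear_ml p : multilinear (ml p).
Proof.
move=> m /msupp_sum_le /flattenP[_ /mapP[m' _ ->] /msuppZ_le].
rewrite msuppX inE => /eqP ->; exists [set i | (0 < m' i)%N].
by apply/mnmP => i; rewrite !mnmE inE.
Qed.

(** Both 0 and 1 are fixed by every positive power, and [ml] leaves a zero exponent at zero. *)
Lemma meval_ml p A : (ml p).@[indicator A] = p.@[indicator A].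
Proof.
rewrite [in RHS](mpolyE p) /ml !raddf_sum /=; apply: eq_bigr => m _.
rewrite !mevalZ !mevalX; congr (_ * _); apply: eq_bigr => i _.
rewrite mnmE /indicator; case: (m i) => [//|k].
by case: (i \in A); rewrite ?expr1n // !expr0n.
Qed.

Lemma prod_one_subX S :
  \prod_(i in S) (1 - 'X_i) =
  \sum_(J : {set 'I_n} | J \subset S) (-1) ^+ #|J| *: 'X_[mesym1 J]
    :> {mpoly F[n]}.
Proof.
rewrite big_mkcond /=.
(* Writing a factor outside [S] as [0 + 1] lets the distributive law run over all index sets [J];
   those not contained in [S] pick up a factor 0. *)
rewrite (eq_bigr (fun i : 'I_n => (if i \in S then - 'X_i else 0) + 1)); last first.
  by move=> i _; case: ifP => _; rewrite addrC ?addr0.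
rewrite bigA_distr [RHS]big_mkcond /=; apply: eq_bigr => J _.
have [/subsetP sJS|/subsetPn[i iJ iS]] := boolP (J \subset S); last first.
  by rewrite (bigD1 i) //= iJ (negbTE iS) mul0r.
rewrite -big_mkcond (eq_bigr (fun i => - 'X_i)) => [|i /sJS -> //].
rewrite prodrN -mul_mpolyC rmorphXn rmorphN1; congr (_ * _).
rewrite mpolyXE_id big_mkcond; apply: eq_bigr => i _.
by rewrite mnmE; case: (i \in J).
Qed.

Lemma multilinear_prod_one_subX S :
  multilinear (\prod_(i in S) (1 - 'X_i)).
Proof.
rewrite prod_one_subX => m /msupp_sum_le /flattenP[_ /mapP[J _ ->]].
by move=> /msuppZ_le; rewrite msuppX inE => /eqP ->; exists J.
Qed.

Lemma mcoeff_prod_one_subX S A :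
  (\prod_(i in S) (1 - 'X_i))@_(mesym1 A) =
  if A \subset S then (-1) ^+ #|A| else 0 :> F.
Proof.
rewrite prod_one_subX raddf_sum /=.
rewrite (eq_bigr (fun J : {set 'I_n} => if J == A then (-1) ^+ #|A| else 0)).
  rewrite -big_mkcondr; case: ifP => sAS.
    rewrite (big_pred1 A) // => J; rewrite andbC /=.
    by have [->|] := eqVneq J A.
  by rewrite big_pred0 // => J; rewrite andbC; have [->|] := eqVneq J A.
move=> J _; rewrite mcoeffZ mcoeffX (inj_eq (@inj_mesym1 n)).
by case: eqP => [->|_]; rewrite ?mulr1 ?mulr0.
Qed.

(** * The polynomial [half_prod S] and its leading monomial *)

Definition half_prod S : {mpoly F[n]} :=
  (- 2%:R^-1) *: (1 + \prod_(i in S) (1 - 'X_i)).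

Lemma multilinear_half_prod S : multilinear (half_prod S).
Proof.
move=> m /msuppZ_le /msuppD_le; rewrite mem_cat => /orP[|].
  by rewrite msupp1 inE => /eqP ->; exists set0; rewrite mesym1_set0.
exact: multilinear_prod_one_subX.
Qed.

Lemma meval_prod_one_subX S v :
  (\prod_(i in S) (1 - 'X_i)).@[v] = \prod_(i in S) (1 - v i) :> F.
Proof.
by rewrite rmorph_prod; apply: eq_bigr => i _; rewrite /= mevalB meval1 mevalXU.
Qed.

Lemma mcoeff_half_prod S A : (half_prod S)@_(mesym1 A) =
  - 2%:R^-1 * ((A == set0)%:R + if A \subset S then (-1) ^+ #|A| else 0).
Proof.
rewrite mcoeffZ mcoeffD mcoeff_prod_one_subX mcoeff1 -mesym1_set0.
by rewrite (inj_eq (@inj_mesym1 n)).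
Qed.

Hypothesis F2 : 2%:R != 0 :> F.

Lemma mesym1_half_prod S : mesym1 S \in msupp (half_prod S).
Proof.
rewrite mcoeff_msupp mcoeff_half_prod subxx mulf_eq0 oppr_eq0 invr_eq0.
(* For [S = set0] the constant 1 and the empty product meet in the same coefficient, giving [1 + 1],
   nonzero by [F2]; otherwise only a sign remains. *)
rewrite (negbTE F2) /=; have [->|_] := eqVneq S set0; last by rewrite add0r signr_eq0.
by rewrite cards0 expr0.
Qed.

Lemma msupp_half_prod S m : m \in msupp (half_prod S) ->
  exists2 A : {set 'I_n}, A \subset S & m = mesym1 A.
Proof.
move=> mS; have [A defm] := multilinear_half_prod mS; exists A => //.
move: mS; rewrite defm mcoeff_msupp mcoeff_half_prod.
case: (A =P set0) => [->|_]; first by rewrite sub0set.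
by case: (A \subset S); rewrite // addr0 mulr0 eqxx.
Qed.

Lemma idempotent_half (w h : F) : w * w = w -> h * (w - 2%:R) = 1 ->
  h = - 2%:R^-1 * (1 + w).
Proof.
move=> ww hw; apply: (mulfI F2); rewrite mulrA mulrN divff //.
(* Adding [w - w * w = 0] to 2 makes it factor as [- (w - 2) * (1 + w)], which exposes
   [h * (w - 2)]. *)
have -> : 2%:R * h = (2%:R + w - w * w) * h by rewrite ww addrK.
have -> : (2%:R + w - w * w) * h = - (h * (w - 2%:R)) * (1 + w) by ring.
by rewrite hw.
Qed.

(** Antisymmetry forces every element that survives the filter in [LM] to equal [m]. *)
Lemma LM_max (le : rel 'X_{1..n}) p m : reflexive le -> antisymmetric le ->
  m \in msupp p -> (forall m', m' \in msupp p -> le m' m) -> LM le p = Some m.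
Proof.
move=> le_refl le_anti mp mmax; rewrite /LM.
set s := [seq _ <- _ | _].
have ms : m \in s by rewrite mem_filter mp andbT; apply/allP.
have sm m' : m' \in s -> m' = m.
  rewrite mem_filter => /andP[/allP m'max m'p].
  by apply: le_anti; rewrite mmax //= m'max.
by case: s ms sm => [//|a s] _ /(_ a (mem_head _ _)) ->.
Qed.

(** Any other monomial in the support comes from a proper subset of [S], so it has smaller degree
    and [hdeg] already decides the comparison. *)
Lemma LM_half_prod (le : rel 'X_{1..n}) S :
  monomial_order le -> refines_degree le ->
  LM le (half_prod S) = Some (mesym1 S).
Proof.
move=> [[le_refl le_anti _ _] _] hdeg.
apply: LM_max => // [|m /msupp_half_prod[A sAS ->]].
  exact: mesym1_half_prod.
have [->//|neqAS] := eqVneq A S.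
have /hdeg/andP[] // : (mdeg (mesym1 A) < mdeg (mesym1 S))%N.
by rewrite !mdeg_mesym1 proper_card // properEneq neqAS.
Qed.

End BooleanCube.

Lemma meval_eq_mod_ideal (R : comNzRingType) (k : nat) (I : finType)
    (gs : I -> {mpoly R[k]}) (p r : {mpoly R[k]}) (v : 'I_k -> R) :
  (forall i, (gs i).@[v] = 0) -> eq_mod_ideal gs p r -> p.@[v] = r.@[v].
Proof.
move=> gs0 [a defpr]; apply/eqP; rewrite -subr_eq0 -mevalB defpr raddf_sum /=.
by apply/eqP/big1 => i _; rewrite mevalM gs0 mulr0.
Qed.

(** * Evaluating the hypothesis on [g] at Boolean points *)

Section InverseOnCube.

Variables (F : fieldType) (n : nat) (g : {mpoly F[n + n]}).
Hypothesis F2 : 2%:R != 0 :> F.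
Hypothesis hg :
  eq_mod_ideal (x_axiom F n) (g * hadamard_lift (f_prod F n)) 1 \/
  eq_mod_ideal (xy_axiom F n) (g * hadamard_lift (f_prod F n)) 1.

Definition xy_point (A S : {set 'I_n}) (k : 'I_(n + n)) : F :=
  match split k with inl i => indicator F A i | inr j => indicator F S j end.

Lemma meval_subst_indicator A S :
  (subst_indicator g S).@[indicator F A] = g.@[xy_point A S].
Proof.
rewrite comp_mpoly_meval; apply: meval_eq => k; rewrite tnth_mktuple /xy_point.
by case: (split k) => i; rewrite ?mevalXU ?mevalC.
Qed.

Lemma xy_point_idem A S k : xy_point A S k ^+ 2 - xy_point A S k = 0.
Proof.
rewrite /xy_point; case: (split k) => i; rewrite /indicator;
by case: (_ \in _); rewrite ?expr1n ?expr0n subrr.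
Qed.

Lemma meval_inverse A S :
  g.@[xy_point A S] * (\prod_(i in S) (1 - indicator F A i) - 2%:R) = 1.
Proof.
have : (g * hadamard_lift (f_prod F n)).@[xy_point A S]
       = (1 : {mpoly F[n + n]}).@[xy_point A S].
  (* All [n + n] coordinates of the point are Boolean, so the generators of either ideal vanish
     there. *)
  case: hg; apply: meval_eq_mod_ideal => k;
    by rewrite mevalB rmorphXn /= mevalXU xy_point_idem.
rewrite mevalM meval1 comp_mpoly_meval => hg1; rewrite -[RHS]hg1; congr (_ * _).
rewrite mevalB rmorph_nat; congr (_ - _).
(* Where [y_i = 0] the factor [1 - x_i * y_i] is 1, so only the indices in [S] contribute. *)
rewrite rmorph_prod big_mkcond; apply: eq_bigr => i _ /=.
rewrite mevalB meval1 mevalXU tnth_mktuple mevalM !mevalXU /xy_point.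
rewrite (unsplitK (inl i)) (unsplitK (inr i)) /indicator.
by case: (i \in S); rewrite ?mulr1 // mulr0 subr0.
Qed.

Lemma ml_subst_indicator S : ml (subst_indicator g S) = half_prod F S.
Proof.
apply: multilinear_inj => [||A]; first exact: multilinear_ml.
  exact: multilinear_half_prod.
rewrite meval_ml meval_subst_indicator mevalZ mevalD meval1 meval_prod_one_subX.
apply: idempotent_half (meval_inverse A S) => //.
(* The product is idempotent because each of its factors is 0 or 1. *)
rewrite -big_split /=; apply: eq_bigr => i _; rewrite /indicator.
by case: (i \in A); rewrite ?subrr ?mulr0 // subr0 mulr1.
Qed.

End InverseOnCube.

Theorem theorem5p2 (F : finFieldType) (q : nat) (hq : q \in [pchar F])
  (hq2 : (2 < q)%N) (n : nat) (le : rel 'X_{1..n})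
  (hle : monomial_order le) (hdeg : refines_degree le)
  (g : {mpoly F[n + n]})
  (hg : eq_mod_ideal (x_axiom F n) (g * hadamard_lift (f_prod F n)) 1 \/
        eq_mod_ideal (xy_axiom F n) (g * hadamard_lift (f_prod F n)) 1) :
  #|` LM_set le [fset ml (subst_indicator g S) | S in [set: {set 'I_n}]]%fset |
    = (2 ^ n)%N.
Proof.
(* The characteristic [q > 2] cannot divide 2. *)
have F2 : 2%:R != 0 :> F by rewrite -(dvdn_pcharf hq) gtnNdvd.
have LM_g S : LM le (ml (subst_indicator g S)) = Some (mesym1 S).
  by rewrite (ml_subst_indicator F2 hg) LM_half_prod.
have -> : LM_set le [fset ml (subst_indicator g S) | S in [set: {set 'I_n}]]%fset
          = [fset mesym1 S | S in [set: {set 'I_n}]]%fset.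
  apply/fsetP => m; rewrite !inE mem_pmap.
  apply/mapP/imfsetP => [[p /imfsetP[S _ ->]]|[S _ ->]] /=.
    by rewrite LM_g => -[->]; exists S; rewrite ?inE.
  exists (ml (subst_indicator g S)); rewrite ?LM_g //.
  by apply/imfsetP; exists S; rewrite ?inE.
rewrite card_imfset /=; last exact: inj_mesym1.
by rewrite -cardE -powersetT card_powerset cardsT card_ord.
Qed.
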